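(* Let $\Theta\subseteq\mathbb{R}$ be an interval and let $g:\Theta\to\mathbb{R}$ be a function such that the equation $g(\theta)=0$, $\theta\in\Theta$, has a unique root $\theta^*$, with $g(\theta)>0$ for all $\theta<\theta^*$ and $g(\theta)<0$ for all $\theta>\theta^*$ ($\theta\in\Theta$). Suppose $g(\theta)=G(u_1(\theta),\ldots,u_m(\theta))$, where $u_1,\ldots,u_m$ are differentiable univariate functions on $\Theta$ and $G$ is a differentiable function of $m$ variables, and suppose that for some $1\le r<m$, $$\frac{\partial G(u_1(\theta),\ldots,u_m(\theta))}{\partial u_j(\theta)}\,u_j'(\theta)\ge 0,\qquad\forall\,j=1,\ldots,r,\ \forall\,\theta\in\Theta.$$ Let the $U$-function $$U_{1\cdots r}(\theta|\theta^{(t)})=G\big(u_1(\theta^{(t)}),\ldots,u_r(\theta^{(t)}),u_{r+1}(\theta),\ldots,u_m(\theta)\big),\qquad\theta,\theta^{(t)}\in\Theta,$$ satisfy the Lipschitz condition $|U_{1\cdots r}(\theta_1|\theta^{(t)})-U_{1\cdots r}(\theta_2|\theta^{(t)})|\le L|\theta_1-\theta_2|$ for any $\theta_1$ and $\theta_2$ located between $\theta^{(0)}$ and $\theta^*$. Then the US iteration $$\theta^{(t+1)}=h(\theta^{(t)}),\qquad h(\theta^{(t)}):=\text{the solution in }\theta\in\Theta\text{ of }U_{1\cdots r}(\theta|\theta^{(t)})=0,$$ holds a linear convergence rate given by $$\lim_{t\to\infty}\frac{|\theta^{(t+1)}-\theta^*|}{|\theta^{(t)}-\theta^*|}=|h'(\theta^*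 )|=\left|1-\frac{g'(\theta^* )}{U_{1\cdots r}'(\theta^*|\theta^* )}\right|=1-\frac{g'(\theta^* )}{U_{1\cdots r}'(\theta^*|\theta^* )}\in[0,1),$$ where $$U_{1\cdots r}'(\theta^*|\theta^* )=\frac{dU_{1\cdots r}(\theta|\theta^* )}{d\theta}\bigg|_{\theta=\theta^*}=\sum_{j=r+1}^m\frac{\partial G\big(u_1(\theta^* ),\ldots,u_r(\theta^* ),u_{r+1}(\theta),\ldots,u_m(\theta)\big)}{\partial u_j(\theta)}u_j'(\theta)\bigg|_{\theta=\theta^*}.$$
   Context: Here $\partial G/\partial u_j$ denotes the partial derivative of $G$ with respect to its $j$-th argument, and $\theta^{(0)}\in\Theta$ is the initial value of the iteration. $U$-function: for $\theta^{(t)}\in\Theta$, a function $U(\theta|\theta^{(t)})$ of $\theta\in\Theta$ is called a $U$-function for $g$ at $\theta=\theta^{(t)}$ if $g(\theta)\le U(\theta|\theta^{(t)})$ for $\theta<\theta^{(t)}$, $g(\theta^{(t)})=U(\theta^{(t)}|\theta^{(t)})$, and $g(\theta)\ge U(\theta|\theta^{(t)})$ for $\theta>\theta^{(t)}$. The rate of convergence of the iteration $\theta^{(t+1)}=h(\theta^{(t)})$ is defined as $\lim_{t\to\infty}|\theta^{(t+1)}-\theta^*|/|\theta^{(t)}-\theta^*|$, which is identified with $|h'(\theta^* )|$ through the Taylor expansion $h(\theta^{(t)})=h(\theta^* )+(\theta^{(t)}-\theta^* )h'(\theta^* )+\tfrac12(\theta^{(t)}-\theta^* )^2h''(\tilde\theta)$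 with $\tilde\theta$ between $\theta^{(t)}$ and $\theta^*$.
   Formalization: Adds g'(θ* )≠0, without which the rate can equal 1 (e.g. g(θ)=−θ³ with u₁=θ, u₂=−θ−θ³, G the sum); that U_{1…r}(·|s) is a U-function is taken as assumed; the ratio limit is stated when no iterate equals θ*, since otherwise it is 0/0. *)

(* Defs.v *)
From HB Require Import structures.
From mathcomp Require Import all_boot all_order all_algebra.
From mathcomp Require Import all_classical all_reals all_analysis.

Set Implicit Arguments.
Unset Strict Implicit.
Unset Printing Implicit Defensive.

Import Order.TTheory GRing.Theory Num.Theory.
Import numFieldNormedType.Exports.

Local Open Scope classical_set_scope.
Local Open Scope ring_scope.

(* Functions on an interval Theta are total functions R -> R that are only
   looked at on Theta. Their derivatives are therefore limits of difference
   quotients along points of Theta: the usual derivative in the interior of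
   Theta, the one-sided derivative at an endpoint belonging to Theta. *)
Definition diff_quotient (R : realType) (f : R -> R) (x y : R) : R :=
  (f y - f x) / (y - x).

Definition derivable_on (R : realType) (Theta : set R) (f : R -> R) (x : R) :
    Prop :=
  cvg (diff_quotient f x y @[y --> within Theta x^']).

Definition derive_on (R : realType) (Theta : set R) (f : R -> R) (x : R) : R :=
  lim (diff_quotient f x y @[y --> within Theta x^']).

Definition partial (R : realType) (m : nat) (G : 'rV[R]_m -> R) (j : 'I_m)
    (x : 'rV[R]_m) : R :=
  'D_(delta_mx 0 j) G x.

(* U stands for U( . | s): its argument is the first one of U(theta | s). *)
Definition is_U_function (R : realType) (Theta : set R) (g : R -> R) (s : R)
    (U : R -> R) : Prop :=
  [/\ forall x, Theta x -> x < s -> g x <= U x,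
      g s = U s
    & forall x, Theta x -> s < x -> U x <= g x].

(* (u_1(s), ..., u_r(s), u_{r+1}(x), ..., u_m(x)); indices start at 0 here, so
   the coordinates 1, ..., r are those with j < r. *)
Definition split_arg (R : realType) (m r : nat) (u : 'I_m -> R -> R)
    (s x : R) : 'rV[R]_m :=
  \row_(j < m) u j (if (j < r)%N then s else x).

(* U_{1...r}(x | s) *)
Definition U_split (R : realType) (m r : nat) (G : 'rV[R]_m -> R)
    (u : 'I_m -> R -> R) (x s : R) : R :=
  G (split_arg r u s x).

(* Main.v *)
(* For s < ts the function U(. | s) is positive at s and nonpositive at ts, so
   s < h(s) <= ts, and symmetrically for s > ts. Hence |h(s) - ts| <= |s - ts|,
   and theta is monotone and bounded; its limit l satisfies U(l | l) = 0, that
   is g(l) = 0, so l = ts. Let A and B be the sums of (dG/du_j) u_j' at ts over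
   j <= r and over j > r, so that g' = A + B and U' = B. Since
   |h(s) - ts| <= |s - ts|, differentiability of G at u(ts) turns U(h(s) | s) = 0
   into A (s - ts) + B (h(s) - ts) = o(s - ts). Finally A >= 0, while g' <= 0 by
   the sign change and g' <> 0, so B < 0 and h' = - A / B = 1 - g' / U'. *)
Require Import Defs.
From HB Require Import structures.
From mathcomp Require Import all_boot all_order all_algebra.
From mathcomp Require Import all_classical all_reals all_analysis.
From mathcomp Require Import ring lra.

Set Implicit Arguments.
Unset Strict Implicit.
Unset Printing Implicit Defensive.

Import Order.TTheory GRing.Theory Num.Theory.
Import numFieldNormedType.Exports.

Local Open Scope classical_set_scope.
Local Open Scope ring_scope.

(** * Derivatives relative to an interval *)

(* Caratheodory's form of the derivative: slope is continuous at x. *)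
Definition slope (R : realType) (Theta : set R) (f : R -> R) (x y : R) : R :=
  if y == x then derive_on Theta f x else diff_quotient f x y.

Lemma slopeE (R : realType) (Theta : set R) (f : R -> R) (x y : R) :
  f y = f x + (y - x) * slope Theta f x y.
Proof.
rewrite /slope /diff_quotient; case: eqVneq => [->|yx].
  by rewrite subrr mul0r addr0.
by rewrite mulrC divfK ?subr_eq0// addrC subrK.
Qed.

(** The value given to the slope at [x] lets the full neighbourhood replace the punctured one. This
    matters because evaluation points such as [h s] may coincide with [x]. *)
Lemma cvg_slope (R : realType) (Theta : set R) (f : R -> R) (x : R) :
  derivable_on Theta f x ->
  slope Theta f x y @[y --> within Theta (nbhs x)] --> derive_on Theta f x.
Proof.
move=> df A Al.
have H : nbhs x [set y | y != x -> Theta y -> A (diff_quotient f x y)] := df _ Al.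
suff : nbhs x [set y | Theta y -> A (slope Theta f x y)] by [].
apply: filterS H => y H Ty; rewrite /slope.
by case: eqVneq => [_|yx]; [exact: nbhs_singleton | exact: H].
Qed.

Lemma derivable_on_cvg (R : realType) (Theta : set R) (f : R -> R) (x : R) :
  derivable_on Theta f x ->
  f y @[y --> within Theta (nbhs x)] --> f x.
Proof.
move=> df.
have -> : f = fun y => f x + (y - x) * slope Theta f x y.
  by apply/funext => y; exact: slopeE.
(* The target [f x] has been rewritten as well, into [f x + (x - x) * slope Theta f x x], so both
   sides have the same shape. *)
rewrite /= subrr; apply: cvgD; first exact: cvg_cst.
apply: cvgM; last first.
  have -> : slope Theta f x x = derive_on Theta f x by rewrite /slope eqxx.
  exact: cvg_slope.
rewrite -(subrr x); apply: cvgB; last exact: cvg_cst.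
exact: cvg_within.
Qed.

(** All points between [x] and [c] belong to the interval, so a one-sided punctured neighbourhood of
    [x] lies in [Theta]. Properness gives uniqueness of the limits that define [derive_on]. *)
Lemma proper_within_dnbhs (R : realType) (Theta : set R) (x c : R) :
  is_interval Theta -> Theta x -> Theta c -> c != x ->
  ProperFilter (within Theta x^').
Proof.
move=> itv Tx Tc; rewrite neq_lt => /orP[cx|xc].
  have sub : x^'- `=>` within Theta x^'.
    move=> A HA.
    have {}HA : nbhs x [set y | y != x -> Theta y -> A y] := HA.
    have Hc : nbhs x [set y | c < y] := lt_nbhsr cx.
    suff : nbhs x [set y | y < x -> A y] by [].
    apply: filterS2 HA Hc => y H cy yx; apply: H; first by rewrite lt_eqF.
    by apply: (itv c x Tc Tx); rewrite !ltW.
  by apply: Build_ProperFilter => /sub /filter_ex[].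
have sub : x^'+ `=>` within Theta x^'.
  move=> A HA.
  have {}HA : nbhs x [set y | y != x -> Theta y -> A y] := HA.
  have Hc : nbhs x [set y | y < c] := lt_nbhsl xc.
  suff : nbhs x [set y | x < y -> A y] by [].
  apply: filterS2 HA Hc => y H cy yx; apply: H; first by rewrite gt_eqF.
  by apply: (itv x c Tx Tc); rewrite !ltW.
by apply: Build_ProperFilter => /sub /filter_ex[].
Qed.

(** * Limits of row vectors and first-order expansion of composites *)

Lemma cvg_row (R : realType) (m : nat) (T : Type) (F : set_system T)
    {FF : Filter F} (v : T -> 'rV[R]_m) (l : 'rV[R]_m) :
  (forall j, v t 0 j @[t --> F] --> l 0 j) -> v t @[t --> F] --> l.
Proof.
move=> vl; rewrite (row_sum_delta l).
under eq_fun do rewrite (row_sum_delta (v _)).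
apply: cvg_big; first exact: add_continuous.
by move=> j _; apply: cvgZr_tmp.
Qed.

(* The direction d t need not converge: in the application it depends on
   (h s - ts) / (s - ts), of which only boundedness is known beforehand. *)
Lemma cvg_diff_quotient_bounded_dir (R : realType) (V : normedModType R)
    (G : V -> R) (v0 : V) (T : Type) (F : set_system T) {FF : Filter F}
    (w : T -> R) (d : T -> V) (M : R) :
  differentiable G v0 ->
  w t @[t --> F] --> 0 ->
  (\forall t \near F, w t != 0) ->
  (\forall t \near F, `|d t| <= M) ->
  (G (w t *: d t + v0) - G v0) / w t - 'd G v0 (d t) @[t --> F] --> 0.
Proof.
move=> dG w0 wN0 dM; apply/cvgr0Pnorm_le => e e0.
have M0 : 0 < `|M| + 1 by rewrite ltr_wpDl.
have wd0 : w t *: d t @[t --> F] --> (0 : V).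
  apply/cvgr0Pnorm_le => eps eps0.
  have : \forall t \near F, `|w t| <= eps / (`|M| + 1).
    by move/cvgr0Pnorm_le : w0; apply; rewrite divr_gt0.
  move=> w_small; near=> t; rewrite normrZ.
  rewrite -(divfK (lt0r_neq0 M0) eps) ler_pM//; first by near: t.
  have dt : `|d t| <= M by near: t.
  by rewrite (le_trans dt)// (le_trans (ler_norm M))// lerDl.
(* This is the constant for the little-o of [G] at [v0]: with [|d t| <= |M| + 1], division by
   [|w t|] leaves exactly [e]. *)
have e'0 : 0 < e / (`|M| + 1) by rewrite divr_gt0.
have H : \forall t \near F,
    `|G (w t *: d t + v0) - G v0 - 'd G v0 (w t *: d t)|
      <= e / (`|M| + 1) * `|w t *: d t|.
  suff H0 : \forall k \near (0 : V),
      `|G (k + v0) - G v0 - 'd G v0 k| <= e / (`|M| + 1) * `|k|.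
    exact: (wd0 _ H0).
  near=> k; rewrite (diff_locallyx dG).
  have cancel (a b c : R) : a + b + c - a - b = c by ring.
  rewrite cancel.
  by near: k; apply: littleoP.
near=> t.
have wt : w t != 0 by near: t.
have -> : (G (w t *: d t + v0) - G v0) / w t - 'd G v0 (d t) =
    (G (w t *: d t + v0) - G v0 - 'd G v0 (w t *: d t)) / w t.
  have -> : 'd G v0 (w t *: d t) = w t * 'd G v0 (d t) by rewrite linearZ.
  by rewrite [RHS]mulrBl [w t * _]mulrC mulfK.
rewrite normrM normfV ler_pdivrMr ?normr_gt0//.
have Ht : `|G (w t *: d t + v0) - G v0 - 'd G v0 (w t *: d t)|
    <= e / (`|M| + 1) * `|w t *: d t| by near: t.
apply: (le_trans Ht); rewrite normrZ.
have dt : `|d t| <= `|M| + 1.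
  have dt : `|d t| <= M by near: t.
  by rewrite (le_trans dt)// (le_trans (ler_norm M))// lerDl.
have -> : e * `|w t| = e / (`|M| + 1) * (`|w t| * (`|M| + 1)).
  by field; rewrite lt0r_neq0.
by rewrite ler_pM2l// ler_pM2l ?normr_gt0.
Unshelve. all: by end_near. Qed.

(** Each coordinate has its own evaluation point [y j s], no farther from [x] than [s]. Then
    [u j (y j s)] is [u j x + (s - x) * (q j s * a j s)] with [a] the slope and [|q| <= 1], so the
    argument of [G] moves by [s - x] times a bounded direction. *)
Lemma cvg_composite_quotient (R : realType) (Theta : set R) (m : nat)
    (u : 'I_m -> R -> R) (G : 'rV[R]_m -> R) (x : R) (y : 'I_m -> R -> R) :
  (forall j, derivable_on Theta (u j) x) ->
  differentiable G (\row_(j < m) u j x) ->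
  (forall j s, Theta s -> Theta (y j s)) ->
  (forall j s, Theta s -> `|y j s - x| <= `|s - x|) ->
  (G (\row_(j < m) u j (y j s)) - G (\row_(j < m) u j x)) / (s - x)
    - \sum_(j < m) partial G j (\row_(k < m) u k x)
        * derive_on Theta (u j) x * ((y j s - x) / (s - x))
    @[s --> within Theta x^'] --> 0.
Proof.
move=> du dG yT yx; set v0 := \row_(j < m) u j x; set F := within Theta x^'.
pose a j s := slope Theta (u j) x (y j s); pose q j s := (y j s - x) / (s - x).
pose d s : 'rV[R]_m := \row_(j < m) (q j s * a j s).
have FF : Filter F by exact: within_filter.
have FT : \forall s \near F, Theta s by apply: withinT.
have Fx : \forall s \near F, s != x by apply: cvg_within; apply: withinT.
have sx0 : s - x @[s --> F] --> 0.
  rewrite -(subrr x); apply: cvgB; last exact: cvg_cst.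
  by move=> A /nbhs_dnbhs; exact: cvg_within.
have yF j : y j s @[s --> F] --> within Theta (nbhs x).
  have yjx : y j s @[s --> F] --> x.
    apply/cvgrPdist_le => e e0; near=> s; rewrite distrC.
    apply: (le_trans (yx j s _)); first by near: s.
    by near: s; move/cvgr0Pnorm_le : sx0; apply.
  move=> A HA; have {}HA : nbhs x [set z | Theta z -> A z] := HA.
  have := yjx _ HA; apply: filterS2 FT => s Ts; apply; exact: yT.
have aF j : a j s @[s --> F] --> derive_on Theta (u j) x.
  exact: (cvg_comp _ _ (yF j) (cvg_slope (du j))).
have q1 j : \forall s \near F, `|q j s| <= 1.
  near=> s; rewrite normrM normfV ler_pdivrMr ?normr_gt0 ?subr_eq0 ?mul1r.
    by apply: yx; near: s.
  by near: s.
(* Near [x] each slope is within its limit plus 1 in absolute value, and each [q j s] is at most 1;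
   hence this bound on [d]. *)
pose M := \sum_(j < m) (`|derive_on Theta (u j) x| + 1) * `|delta_mx 0 j : 'rV[R]_m|.
have dM : \forall s \near F, `|d s| <= M.
  have aM : \forall s \near F, forall j, `|a j s| <= `|derive_on Theta (u j) x| + 1.
    apply: filter_forall => j.
    by apply: (cvgr_le _ (cvg_norm (aF j))); rewrite ltrDl.
  have qM : \forall s \near F, forall j, `|q j s| <= 1 by exact: filter_forall.
  near=> s.
  have as_le : forall j, `|a j s| <= `|derive_on Theta (u j) x| + 1 by near: s.
  have qs_le : forall j, `|q j s| <= 1 by near: s.
  rewrite (row_sum_delta (d s)) (le_trans (ler_norm_sum _ _ _))//.
  apply: ler_sum => j _; rewrite normrZ ler_wpM2r// mxE normrM -[leRHS]mul1r.
  exact: ler_pM.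
have sxN0 : \forall s \near F, s - x != 0.
  by apply: filterS Fx => s; rewrite subr_eq0.
have main := cvg_diff_quotient_bounded_dir dG sx0 sxN0 dM.
have dE s : 'd G v0 (d s) = \sum_(j < m) partial G j v0 * (q j s * a j s).
  rewrite [in LHS](row_sum_delta (d s)) linear_sum; apply: eq_bigr => j _.
  by rewrite linearZ /= /partial deriveE// mxE; exact: mulrC.
(* Cost of replacing the slopes by the derivatives. As [q j s] is only known to be bounded, the
   product tends to 0 by a direct estimate. *)
have corr : \sum_(j < m) partial G j v0 * (q j s * (a j s - derive_on Theta (u j) x))
    @[s --> F] --> 0.
  rewrite [X in _ --> X](_ : _ = \sum_(j < m) (partial G j v0 * 0)); last first.
    by rewrite big1// => j _; rewrite mulr0.
  apply: cvg_big => [|j _]; first exact: add_continuous.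
  apply: cvgM; first exact: cvg_cst.
  have a0 : a j s - derive_on Theta (u j) x @[s --> F] --> 0.
    by rewrite -(subrr (derive_on Theta (u j) x)); apply: cvgB => //; exact: cvg_cst.
  apply/cvgr0Pnorm_le => e e0; near=> s; rewrite normrM -[leRHS]mul1r.
  apply: ler_pM => //; first by near: s.
  by near: s; move/cvgr0Pnorm_le : a0; apply.
have sum0 := cvgD (main FF) corr; rewrite addr0 in sum0.
apply: (cvg_trans _ (sum0 FF)); apply: near_eq_cvg.
near=> s; apply/esym; rewrite /= fctE -/v0 dE.
have sx : s - x != 0 by near: s.
have -> : (s - x) *: d s + v0 = \row_(j < m) u j (y j s).
  apply/rowP => j; rewrite !mxE [RHS](slopeE Theta _ x) addrC; congr (_ + _).
  by rewrite mulrA; congr (_ * _); rewrite mulrC divfK.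
rewrite -addrA; congr (_ + _).
rewrite addrC -sumrB -sumrN; apply: eq_bigr => j _; rewrite /q; ring.
Unshelve. all: by end_near. Qed.

(** * Continuity and roots of [U_split] *)

(** Joint continuity serves twice: with [s] constant for the intermediate value theorem, and with
    both arguments moving along the iteration. *)
Lemma cvg_U_split (R : realType) (Theta : set R) (m r : nat)
    (u : 'I_m -> R -> R) (G : 'rV[R]_m -> R) (a b : R) (T : Type)
    (F : set_system T) {FF : Filter F} (s x : T -> R) :
  (forall j z, Theta z -> derivable_on Theta (u j) z) ->
  differentiable G (split_arg r u a b) ->
  Theta a -> Theta b ->
  s t @[t --> F] --> within Theta (nbhs a) ->
  x t @[t --> F] --> within Theta (nbhs b) ->
  U_split r G u (x t) (s t) @[t --> F] --> U_split r G u b a.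
Proof.
move=> du dG Ta Tb sa xb.
have argE : split_arg r u (s t) (x t) @[t --> F] --> split_arg r u a b.
  apply: cvg_row => j; rewrite mxE; under eq_fun do rewrite mxE.
  case: ifP => _; [apply: cvg_comp sa _ | apply: cvg_comp xb _];
    exact: derivable_on_cvg (du _ _ _).
exact: (cvg_comp _ _ argE (differentiable_continuous dG)).
Qed.

Lemma cvg_within_of (R : realType) (Theta : set R) (a : R) (T : Type)
    (F : set_system T) {FF : Filter F} (s : T -> R) :
  (forall t, Theta (s t)) -> s t @[t --> F] --> a ->
  s t @[t --> F] --> within Theta (nbhs a).
Proof.
move=> Ts sa A HA.
have {}HA : nbhs a [set z | Theta z -> A z] := HA.
have {}HA : F [set t | Theta (s t) -> A (s t)] := sa _ HA.
suff : F [set t | A (s t)] by [].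
by apply: filterS HA => t; apply; exact: Ts.
Qed.

(** Intermediate value theorem on a segment inside [Theta]. Uniqueness of the root later identifies
    [c] with [h s], which locates [h s]. *)
Lemma U_split_root_between (R : realType) (Theta : set R) (m r : nat)
    (u : 'I_m -> R -> R) (G : 'rV[R]_m -> R) (s a b : R) :
  is_interval Theta ->
  (forall j z, Theta z -> derivable_on Theta (u j) z) ->
  (forall z, Theta z -> differentiable G (split_arg r u s z)) ->
  Theta s -> Theta a -> Theta b -> a <= b ->
  0 <= U_split r G u a s -> U_split r G u b s <= 0 ->
  exists c, [/\ a <= c, c <= b, Theta c & U_split r G u c s = 0].
Proof.
move=> itv du dG Ts Ta Tb ab Ua Ub.
have sub : `[a, b]%classic `<=` Theta.
  by move=> z /=; rewrite in_itv /=; exact: itv.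
have cont : {within `[a, b], continuous (fun z => U_split r G u z s)}.
  apply: (continuous_subspaceW sub); apply/subspace_continuousP => z Tz.
  apply: (@cvg_U_split _ Theta) => //; first exact: dG.
  by apply: cvg_within_of => [_|]; [|exact: cvg_cst].
have [|c cab Uc] := IVT ab cont (v := 0).
  by rewrite ge_min Ub orbT le_max Ua.
move: cab; rewrite in_itv /= => /andP[ac cb].
by exists c; split => //; apply: (itv a b); rewrite ?ac.
Qed.

Theorem theorem5 (R : realType) (Theta : set R) (g : R -> R) (ts : R)
    (m r : nat) (u : 'I_m -> R -> R) (D : set 'rV[R]_m) (G : 'rV[R]_m -> R)
    (h : R -> R) (theta : nat -> R) (L : R)
    (* Theta is a (nondegenerate) interval *)
    (Theta_itv : is_interval Theta)
    (Theta_nondeg : exists a b, [/\ Theta a, Theta b & a < b])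
    (* g has the unique root ts in Theta, and crosses 0 downwards there *)
    (g_root : Theta `&` [set x | g x = 0] = [set ts])
    (g_pos : forall x, Theta x -> x < ts -> 0 < g x)
    (g_neg : forall x, Theta x -> ts < x -> g x < 0)
    (* g = G(u_1, ..., u_m), with G differentiable on its open domain D *)
    (r_ge1 : (1 <= r)%N) (r_ltm : (r < m)%N)
    (g_def : forall x, Theta x -> g x = G (\row_(j < m) u j x))
    (u_diff : forall j x, Theta x -> derivable_on Theta (u j) x)
    (D_open : open D)
    (D_arg : forall s x, Theta s -> Theta x -> D (split_arg r u s x))
    (G_diff : forall v, D v -> differentiable G v)
    (G_mono : forall (j : 'I_m) x, (j < r)%N -> Theta x ->
       0 <= partial G j (\row_(k < m) u k x) * derive_on Theta (u j) x)
    (* U_{1...r}( . | s) is a U-function for g, for every s in Theta *)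
    (U_fun : forall s, Theta s ->
       is_U_function Theta g s (fun x => U_split r G u x s))
    (* h(s) is the solution in Theta of U_{1...r}(x | s) = 0 *)
    (h_def : forall s, Theta s ->
       Theta `&` [set x | U_split r G u x s = 0] = [set h s])
    (* the US iteration *)
    (theta_init : Theta (theta 0%N))
    (theta_step : forall t, theta t.+1 = h (theta t))
    (* Lipschitz condition between theta^(0) and ts *)
    (U_lip : forall t,
       L.-lipschitz_[set` `[Num.min (theta 0%N) ts, Num.max (theta 0%N) ts]]
         (fun x => U_split r G u x (theta t)))
    (* ts is a simple root of g *)
    (g_simple : derive_on Theta g ts <> 0) :
  let g' := derive_on Theta g ts in
  let U' := derive_on Theta (fun x => U_split r G u x ts) ts in
  let h' := derive_on Theta h ts in
  [/\ [/\ derivable_on Theta g ts,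
          derivable_on Theta (fun x => U_split r G u x ts) ts
        & derivable_on Theta h ts],
      U' = \sum_(j < m | (r <= j)%N)
             partial G j (split_arg r u ts ts) * derive_on Theta (u j) ts,
      [/\ `|h'| = `|1 - g' / U'|,
          `|1 - g' / U'| = 1 - g' / U'
        & 0 <= 1 - g' / U' < 1],
      theta t @[t --> \oo] --> ts
    & (forall t, theta t <> ts) ->
      `|theta t.+1 - ts| / `|theta t - ts| @[t --> \oo] --> `|h'| ].
Proof.

(* Position of [h s] between [s] and the root *)
have Tts : Theta ts by have : [set ts] ts by []; rewrite -g_root => -[].
have gts : g ts = 0 by have : [set ts] ts by []; rewrite -g_root => -[].
have rootP x : Theta x -> g x = 0 -> x = ts.
  by move=> Tx gx; have : [set ts] x by rewrite -g_root.
have hP s : Theta s -> Theta (h s) /\ U_split r G u (h s) s = 0.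
  by move=> Ts; have : [set h s] (h s) by []; rewrite -h_def// => -[].
have hU s x : Theta s -> Theta x -> U_split r G u x s = 0 -> x = h s.
  by move=> Ts Tx Ux; have : [set h s] x by rewrite -h_def.
have dGs s x : Theta s -> Theta x -> differentiable G (split_arg r u s x).
  by move=> Ts Tx; apply: G_diff; exact: D_arg.
have h_le s : Theta s -> s <= ts -> s <= h s <= ts.
  move=> Ts s_ts; have [_ Us U_le] := U_fun _ Ts.
  have [||c [sc cts Tc Uc]] := U_split_root_between Theta_itv u_diff
    (fun z => dGs s z Ts) Ts Ts Tts s_ts.
  (* Sign at the left end: the value there is [g s]. At the right end the [U]-function inequality
     bounds the value by [g ts], which is 0; it needs [s < ts], so [s = ts] is treated apart. *)
  - rewrite -Us; move: s_ts; rewrite le_eqVlt => /predU1P[->|]; first by rewrite gts.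
    by move/g_pos => /(_ Ts)/ltW.
  - move: s_ts; rewrite le_eqVlt => /predU1P[sts|]; last by rewrite -gts; exact: U_le.
    by rewrite -{1}sts -Us sts gts.
  by rewrite -(hU _ _ Ts Tc Uc) sc.
have h_ge s : Theta s -> ts <= s -> ts <= h s <= s.
  move=> Ts ts_s; have [U_ge Us _] := U_fun _ Ts.
  have [||c [sc cts Tc Uc]] := U_split_root_between Theta_itv u_diff
    (fun z => dGs s z Ts) Ts Tts Ts ts_s.
  - move: ts_s; rewrite le_eqVlt => /predU1P[tss|]; last by rewrite -gts; exact: U_ge.
    by rewrite {1}tss -Us -tss gts.
  - rewrite -Us; move: ts_s; rewrite le_eqVlt => /predU1P[<-|]; first by rewrite gts.
    by move/g_neg => /(_ Ts)/ltW.
  by rewrite -(hU _ _ Ts Tc Uc) sc.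
have hts : h ts = ts.
  by apply/eqP; rewrite eq_le andbC; apply: h_le.
have h_contr s : Theta s -> `|h s - ts| <= `|s - ts|.
  move=> Ts; have [s_ts|/ltW ts_s] := leP s ts.
    by have /andP[? ?] := h_le _ Ts s_ts; rewrite !ler0_norm ?subr_le0//; lra.
  by have /andP[? ?] := h_ge _ Ts ts_s; rewrite !ger0_norm ?subr_ge0//; lra.

(* First-order expansions at the root *)
set F := within Theta ts^'.
have FF : ProperFilter F.
  have [a [b [Ta Tb ab]]] := Theta_nondeg.
  have [ats|ats] := eqVneq a ts; last exact: proper_within_dnbhs ats.
  by apply: (proper_within_dnbhs (c := b)) => //; rewrite -ats gt_eqF.
have FT : \forall s \near F, Theta s by apply: withinT.
have Fts : \forall s \near F, s - ts != 0.
  have : \forall s \near F, s != ts by apply: cvg_within; apply: withinT.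
  by apply: filterS => s; rewrite subr_eq0.
have rowts : split_arg r u ts ts = \row_(j < m) u j ts.
  by apply/rowP => j; rewrite !mxE if_same.
have Ug s : Theta s -> g s = U_split r G u s s.
  by move=> Ts; have [_] := U_fun _ Ts.
have dGts : differentiable G (\row_(j < m) u j ts) by rewrite -rowts; exact: dGs.
pose c j := partial G j (\row_(k < m) u k ts) * derive_on Theta (u j) ts.
pose A := \sum_(j < m | (j < r)%N) c j.
pose B := \sum_(j < m | (r <= j)%N) c j.
(* The first [r] coordinates follow [p], the others [k]. The pairs [(id, id)], [(cst ts, id)] and
   [(id, h)] yield the derivatives of [g], of [U_split] at [ts], and of [h]. *)
have expansion (p k : R -> R) :
    (forall s, Theta s -> Theta (p s)) -> (forall s, Theta s -> Theta (k s)) ->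
    (forall s, Theta s -> `|p s - ts| <= `|s - ts|) ->
    (forall s, Theta s -> `|k s - ts| <= `|s - ts|) ->
    U_split r G u (k s) (p s) / (s - ts)
      - (A * ((p s - ts) / (s - ts)) + B * ((k s - ts) / (s - ts)))
      @[s --> F] --> 0.
  move=> pT kT pts kts.
  pose y (j : 'I_m) s := if (j < r)%N then p s else k s.
  have yT j s : Theta s -> Theta (y j s).
    by rewrite /y; case: ifP => _; [exact: pT | exact: kT].
  have yts j s : Theta s -> `|y j s - ts| <= `|s - ts|.
    by rewrite /y; case: ifP => _; [exact: pts | exact: kts].
  have H := cvg_composite_quotient (fun j => u_diff j ts Tts) dGts yT yts.
  rewrite -g_def// gts in H.
  apply: (cvg_trans _ H); apply: near_eq_cvg; apply: filterE => s /=.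
  rewrite subr0; congr (_ - _).
  rewrite (bigID (fun j : 'I_m => (j < r)%N)) /= !mulr_suml; congr (_ + _).
    by apply: eq_bigr => j jr; rewrite /y jr.
  apply: eq_big => [j|j jr]; first by rewrite -leqNgt.
  by rewrite /y (negbTE jr).
have quot_id : \forall s \near F, (s - ts) / (s - ts) = 1.
  by apply: filterS Fts => s; exact: divff.
have g_cvg : diff_quotient g ts s @[s --> F] --> A + B.
  have H := expansion id id (fun _ => id) (fun _ => id)
    (fun _ _ => lexx _) (fun _ _ => lexx _).
  have {}H := cvgD H (cvg_cst (A + B)); rewrite add0r in H.
  apply: (cvg_trans _ (H _ _)); apply: near_eq_cvg; near=> s.
  have q1 : (s - ts) / (s - ts) = 1 by near: s.
  have Ts : Theta s by near: s.
  by rewrite /diff_quotient gts subr0 Ug// /= fctE q1 !mulr1 subrK.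
have U_cvg : diff_quotient (fun x => U_split r G u x ts) ts s @[s --> F] --> B.
  have H := expansion (cst ts) id (fun _ _ => Tts) (fun _ => id) _
    (fun _ _ => lexx _).
  have ts_le s : Theta s -> `|cst ts s - ts| <= `|s - ts|.
    by rewrite /= subrr normr0.
  have {}H := cvgD (H ts_le) (cvg_cst B); rewrite add0r in H.
  apply: (cvg_trans _ (H _ _)); apply: near_eq_cvg; near=> s.
  have q1 : (s - ts) / (s - ts) = 1 by near: s.
  rewrite /diff_quotient -Ug// gts subr0 /= fctE /= q1.
  by rewrite subrr mul0r mulr0 add0r mulr1 subrK.

(* Signs of [A] and [B], and the derivative of [h] *)
have A_ge0 : 0 <= A by apply: sumr_ge0 => j jr; exact: G_mono.
have hausR : hausdorff_space R by exact: Rhausdorff.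
have g'E : derive_on Theta g ts = A + B by exact: cvg_lim.
have U'E : derive_on Theta (fun x => U_split r G u x ts) ts = B by exact: cvg_lim.
have AB_le0 : A + B <= 0.
  rewrite -g'E; apply: limr_le; first by apply/cvg_ex; exists (A + B).
  near=> s; have Ts : Theta s by near: s.
  (* On either side of [ts] the values of [g] and [s - ts] have opposite signs, so every difference
     quotient is at most 0. *)
  have : s - ts != 0 by near: s.
  rewrite subr_eq0 /diff_quotient gts subr0 neq_lt => /orP[s_ts|ts_s].
    by rewrite mulr_ge0_le0 ?invr_le0 ?subr_le0 ?(ltW s_ts)// ltW// g_pos.
  by rewrite mulr_le0_ge0 ?invr_ge0 ?subr_ge0 ?(ltW ts_s)// ltW// g_neg.
have AB_lt0 : A + B < 0.
  by rewrite lt_neqAle AB_le0 andbT -g'E; apply/eqP.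
have B_lt0 : B < 0 by lra.
have BN0 : B != 0 by rewrite lt_eqF.
have ratioE : 1 - (A + B) / B = - A / B by field.
have h_cvg : diff_quotient h ts s @[s --> F] --> 1 - (A + B) / B.
  have hT s : Theta s -> Theta (h s) by move=> /hP[].
  have H := expansion id h (fun _ => id) hT (fun _ _ => lexx _) h_contr.
  (* Since [U_split r G u (h s) s] vanishes, [- (A + B * q)] tends to 0, where [q] is the quotient
     of [h]; adding [A] and multiplying by [- B^-1] isolates [q]. *)
  have {}H := cvgM (cvgD H (cvg_cst A)) (cvg_cst (- B^-1)).
  rewrite add0r mulrN -mulNr -ratioE in H.
  apply: (cvg_trans _ (H _ _ _ _)); apply: near_eq_cvg; near=> s.
  have q1 : (s - ts) / (s - ts) = 1 by near: s.
  have Ts : Theta s by near: s.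
  rewrite /diff_quotient hts /= fctE (proj2 (hP _ Ts)) mul0r q1.
  set q := (_ - _) / _.
  by field.
have h'E : derive_on Theta h ts = 1 - (A + B) / B by exact: cvg_lim.
have rate_ge0 : 0 <= 1 - (A + B) / B.
  by rewrite ratioE mulNr -mulrN -invrN mulr_ge0// invr_ge0 oppr_ge0 ltW.
have rate_lt1 : 1 - (A + B) / B < 1.
  by rewrite ltrBlDr ltrDl ltr_ndivlMr// mul0r.

(* Convergence of the iteration *)
have thetaT t : Theta (theta t).
  by elim: t => // t IH; rewrite theta_step; have [] := hP _ IH.
have theta_lim l : Theta l -> theta t @[t --> \oo] --> l -> l = ts.
  move=> Tl tl; apply: rootP => //; rewrite Ug//.
  have tSl : theta t.+1 @[t --> \oo] --> l by rewrite (cvg_shiftS theta).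
  have H : U_split r G u (theta t.+1) (theta t) @[t --> \oo] --> U_split r G u l l.
    apply: (@cvg_U_split _ Theta) => //; first exact: dGs.
      exact: cvg_within_of.
    by apply: cvg_within_of.
  have H0 : U_split r G u (theta t.+1) (theta t) @[t --> \oo] --> (0 : R).
    under eq_fun do rewrite theta_step (proj2 (hP _ (thetaT _))).
    exact: cvg_cst.
  exact: (cvg_unique _ H H0).
have theta_cvg : theta t @[t --> \oo] --> ts.
  have [t0|/ltW t0] := leP (theta 0%N) ts.
    have le_ts t : theta t <= ts.
      by elim: t => // t IH; rewrite theta_step; have /andP[] := h_le _ (thetaT t) IH.
    have nd : nondecreasing_seq theta.
      apply/nondecreasing_seqP => t; rewrite theta_step.
      by have /andP[] := h_le _ (thetaT t) (le_ts t).
    have cv : cvgn theta.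
      by apply: nondecreasing_is_cvgn => //; exists ts => _ [t _ <-].
    (* [Theta] may fail to be closed, but the limit lies between [theta 0] and [ts]. *)
    have Tl : Theta (limn theta).
      apply: (Theta_itv _ _ theta_init Tts); rewrite nondecreasing_cvgn_le//=.
      by apply: limr_le => //; exact: nearW.
    by rewrite -[X in _ --> X](theta_lim _ Tl cv).
  have ge_ts t : ts <= theta t.
    by elim: t => // t IH; rewrite theta_step; have /andP[] := h_ge _ (thetaT t) IH.
  have ni : nonincreasing_seq theta.
    apply/nonincreasing_seqP => t; rewrite theta_step.
    by have /andP[] := h_ge _ (thetaT t) (ge_ts t).
  have cv : cvgn theta.
    by apply: nonincreasing_is_cvgn => //; exists ts => _ [t _ <-].
  have Tl : Theta (limn theta).
    apply: (Theta_itv _ _ Tts theta_init); rewrite nonincreasing_cvgn_ge// andbT.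
    by apply: limr_ge => //; exact: nearW.
  by rewrite -[X in _ --> X](theta_lim _ Tl cv).

(* Conclusion and rate of convergence *)
cbv zeta; rewrite g'E U'E h'E; split => //.
- by split; apply/cvg_ex; [exists (A + B)|exists B|exists (1 - (A + B) / B)].
- by rewrite rowts.
- by split; rewrite ?(ger0_norm rate_ge0)// rate_ge0.
- move=> tN.
  (* As the iterates avoid [ts], they converge to it along the punctured filter, and the error
     ratios are absolute difference quotients of [h]. *)
  have thetaF : theta t @[t --> \oo] --> F.
    move=> S HS.
    have {}HS : nbhs ts [set z | z != ts -> Theta z -> S z] := HS.
    have {}HS := theta_cvg _ HS.
    have {}HS : \forall t \near \oo, theta t != ts -> Theta (theta t) -> S (theta t) by exact: HS.
    suff : \forall t \near \oo, S (theta t) by [].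
    by apply: filterS HS => t; apply => //; apply/eqP.
  apply: (cvg_trans _ (cvg_norm (cvg_comp _ _ thetaF h_cvg))).
  apply: near_eq_cvg; apply: filterE => t.
  by rewrite /= /diff_quotient hts theta_step normrM normfV.
Unshelve. all: by end_near. Qed.
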